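(* It holds that $$\operatorname{conv}(\mathcal{X})=\bigcap_{(\ell,\rho)\in L_1\cup L_2}\operatorname{conv}(\mathcal{X}_{(\ell,\rho)}),$$ where $$\mathcal{X}:=\{(\theta,x)\in\mathbb{R}\times\{0,1\}^n:\theta\le f((x^\top\xi-\beta)^+)\},\qquad \mathcal{X}_{(\ell,\rho)}:=\{(\theta,x)\in\mathbb{R}\times\{0,1\}^n:\theta\le h_{(\ell,\rho)}(x^\top\xi)\}.$$
   Context: Notation: $[m]=\{1,\dots,m\}$; $(t)^+=\max\{t,0\}$; $\operatorname{conv}$ is the convex hull. Let $f:\mathbb{R}_+\to\mathbb{R}$ be a strictly concave increasing function with $f(0)=0$, let $\xi\in\{0,1\}^n$, $\mathcal{Z}:=\{i\in[n]:\xi_i=1\}$, and let $\beta$ be an integer with $1\le\beta\le|\mathcal{Z}|-2$. Put $L:=\{1,\dots,|\mathcal{Z}|-\beta\}$. For $\ell\in L$ let $a_\ell:=f(\ell)-f(\ell-1)$ and $b_\ell:=f(\ell)-a_\ell\ell$; also $a_{|\mathcal{Z}|-\beta+1}:=0$ and $b_{|\mathcal{Z}|-\beta+1}:=f(|\mathcal{Z}|-\beta)$, with the convention $b_{|\mathcal{Z}|-\beta+1}/a_{|\mathcal{Z}|-\beta+1}=+\infty$. Define $$L_1:=\bigcup_{\ell\in L}\{(\ell,\rho):\rho=b_\ell/a_\ell\},\qquad L_2:=\bigcup_{\ell\in L}\left\{(\ell,\rho):\rho\in[\beta]\cap\left(\tfrac{b_\ell}{a_\ell},\tfrac{b_{\ell+1}}{a_{\ell+1}}\right)\right\},$$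 and for $(\ell,\rho)\in L_1\cup L_2$ let $h_{(\ell,\rho)}:\mathbb{R}_+\to\mathbb{R}$, $h_{(\ell,\rho)}(z):=\left(\frac{f(\ell)}{\ell+\rho}\,(z-(\beta-\rho))\right)^+$. *)

(* Defs.v *)
From HB Require Import structures.
From mathcomp Require Import all_boot all_order all_algebra.
From mathcomp Require Import all_classical all_reals.
From mathcomp Require Import convex.

Set Implicit Arguments.
Unset Strict Implicit.
Unset Printing Implicit Defensive.

Import Order.TTheory GRing.Theory Num.Theory.

Local Open Scope classical_set_scope.
Local Open Scope ring_scope.

Definition convex_hull (R : numDomainType) (M : lmodType R)
    (A : set (convex_lmodType M)) : set (convex_lmodType M) :=
  smallest (@convex_set R M) A.

Definition pospart (R : realType) (t : R) : R := Num.max t 0.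

(* A function on the half-line [0, +oo[ is represented by a total f : R -> R
   of which only the values at nonnegative points matter. *)
Definition increasing_nneg (R : realType) (f : R -> R) : Prop :=
  forall x y : R, 0 <= x -> x <= y -> f x <= f y.

Definition strictly_concave_nneg (R : realType) (f : R -> R) : Prop :=
  forall x y t : R, 0 <= x -> 0 <= y -> x != y -> 0 < t -> t < 1 ->
    t * f x + (1 - t) * f y < f (t * x + (1 - t) * y).

Definition binary (R : realType) (n : nat) (x : 'cV[R]_n) : Prop :=
  forall i, x i 0 = 0 \/ x i 0 = 1.

Definition dotp (R : realType) (n : nat) (x y : 'cV[R]_n) : R :=
  (x^T *m y) 0 0.

Definition ones (R : realType) (n : nat) (xi : 'cV[R]_n) : {set 'I_n} :=
  [set i | xi i 0 == 1]%SET.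

Section Coefficients.
Variables (R : realType) (f : R -> R) (m beta : nat).

(* m stands for #|ones xi| - beta. The coefficients are used at 1 <= l <= m.+1; the
   index m.+1 is special: a = 0, b = f m and b / a = +oo. *)
Definition coef_a (l : nat) : R :=
  if (l <= m)%N then f l%:R - f (l.-1)%:R else 0.

Definition coef_b (l : nat) : R :=
  if (l <= m)%N then f l%:R - coef_a l * l%:R else f m%:R.

Definition ratio (l : nat) : \bar R :=
  if (l <= m)%N then (coef_b l / coef_a l)%:E else +oo%E.

Definition L1 : set (nat * R) :=
  [set p | (1 <= p.1 <= m)%N /\ p.2%:E = ratio p.1].

Definition L2 : set (nat * R) :=
  [set p | [/\ (1 <= p.1 <= m)%N,
               exists2 r : nat, (1 <= r <= beta)%N & p.2 = r%:R,
               (ratio p.1 < p.2%:E)%E &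
               (p.2%:E < ratio p.1.+1)%E]].

Definition h (p : nat * R) (z : R) : R :=
  pospart (f p.1%:R / (p.1%:R + p.2) * (z - (beta%:R - p.2))).

End Coefficients.

Definition hypoX (R : realType) (n : nat) (f : R -> R) (xi : 'cV[R]_n)
    (beta : nat) : set (R^o * 'cV[R]_n) :=
  [set p | binary p.2 /\ p.1 <= f (pospart (dotp p.2 xi - beta%:R))].

Definition hypoXh (R : realType) (n : nat) (f : R -> R) (xi : 'cV[R]_n)
    (beta : nat) (q : nat * R) : set (R^o * 'cV[R]_n) :=
  [set p | binary p.2 /\ p.1 <= h f beta q (dotp p.2 xi)].

(* Main.v *)
Require Import Defs.
From HB Require Import structures.
From mathcomp Require Import all_boot all_order all_algebra.
From mathcomp Require Import all_classical all_reals.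
From mathcomp Require Import convex.
From mathcomp Require Import interval_inference.
From mathcomp Require Import ring lra zify.

Set Implicit Arguments.
Unset Strict Implicit.
Unset Printing Implicit Defensive.

Import Order.TTheory GRing.Theory Num.Theory.

Local Open Scope classical_set_scope.
Local Open Scope ring_scope.

(** For x in the cube and a cap c in [0, 1] let phi(c) be the sum of
    min(x_i, c) over the coordinates i with xi_i = 1, and let
    w(c) = phi(c) - beta c be the excess.  Let a_l z + b_l be the affine
    function that agrees with f at l - 1 and l; its graph meets the axis at
    - b_l / a_l.  Both sides of the theorem are described by phi.

    Inner side.  If c > 0, the point x is the convex combination
    c (min(x, c) / c) + (1 - c) ((x - c)^+ / (1 - c)) of two points of the cube.
    The coordinate sum of the first one over xi is phi(c) / c, and when this
    lies between beta + l - 1 and beta + l, the point is a convex combination of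
    0/1 vectors with these two coordinate sums ([slab_rounding]).  Bounding the
    second point by 0, one gets (theta, x) in conv X as soon as
    theta <= a_l w(c) + b_l c and (l - 1) c <= w(c) <= l c
    ([hull_hypoX_chord]).

    Outer side.  As phi is jointly concave in (x, c), the points (theta, x) for
    which some cap c satisfies
    theta <= f(l) / (l + rho) (phi(c) - (beta - rho) c) form a convex set; it
    contains X_(l, rho), hence its hull ([hull_hypoXh]).

    So every pair (l, rho) gives a cap of its own, and a single cap has to be
    found ([sweep_attained]).  The maximisers of phi(c) - g c are explicit: for
    g in [k - 1, k] the k-th largest coordinate c_k is one, and for g <= 0 the
    cap c_0 = 1 is one.  With g = beta - rho, letting k run from 0 to beta makes
    rho decrease to 0, while c_k decreases and w(c_k) / c_k grows.  Meanwhile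
    the contact point l of f with its tangent through (- rho, 0) moves down from
    m to the first chord.  The two motions must cross: either at some c_k, on a
    chord whose line meets the axis at a point - rho for which c_k is optimal (a
    pair of L1), or between c_k and c_(k+1), where phi is affine with slope k and
    the crossing has rho = beta - k, an integer (a pair of L1 or L2).

    The inclusion of conv X in each conv X_(l, rho) is the statement that the
    lines through (- rho, 0) and (l, f(l)) are tangents of f at the integers
    ([concave_le_tangent]). *)

(** * Convex hulls *)

Lemma convex_hull_convex (R : realType) (M : lmodType R)
    (A : set (convex_lmodType M)) (x y : M) (t : R) :
  0 <= t <= 1 -> convex_hull A x -> convex_hull A y ->
  convex_hull A (t *: x + (1 - t) *: y).
Proof.
move=> /andP[t0 t1] Ax Ay B [cB AB].
have := cB x y (Itv01 t0 t1).
rewrite !inE /=; apply; first by apply: Ax.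
by apply: Ay.
Qed.

Lemma convex_hull_min (R : realType) (M : lmodType R)
    (A B : set (convex_lmodType M)) :
  (forall (x y : M) (t : R), 0 <= t <= 1 -> B x -> B y ->
     B (t *: x + (1 - t) *: y)) ->
  A `<=` B -> convex_hull A `<=` B.
Proof.
move=> cB; apply: smallest_sub => x y t; rewrite !inE => Bx By.
by apply: cB => //; rewrite ge0 le1.
Qed.

(** * Chords and tangents of f at the integers *)

Definition secant (R : realType) (f : R -> R) (l : nat) : R :=
  f l%:R - f l.-1%:R.

Definition intercept (R : realType) (f : R -> R) (l : nat) : R :=
  f l%:R - secant f l * l%:R.

(** The perspective c g(w / c) of the affine function g that agrees with f at
    [l.-1] and [l]; homogeneity in (w, c) covers c = 0 without division. *)
Definition chord (R : realType) (f : R -> R) (l : nat) (w c : R) : R :=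
  secant f l * w + intercept f l * c.

(** The line carried by the l-th chord crosses the axis at [- foot f l]. *)
Local Notation foot f l := (intercept f l / secant f l).

Section Chords.
Variables (R : realType) (f : R -> R).
Hypothesis f_concave : strictly_concave_nneg f.
Hypothesis f_incr : increasing_nneg f.
Hypothesis f0 : f 0 = 0.

Lemma midpoint_lt (x y : R) : 0 <= x -> 0 <= y -> x != y ->
  f x + f y < 2 * f ((x + y) / 2).
Proof.
move=> x0 y0 xy.
have half : 1 - 2^-1 = 2^-1 :> R by lra.
have := @f_concave x y 2^-1 x0 y0 xy; rewrite half.
have -> : 2^-1 * x + 2^-1 * y = (x + y) / 2 by lra.
have h0 : 0 < 2^-1 :> R by lra.
have h1 : 2^-1 < 1 :> R by lra.
by move=> /(_ h0 h1); lra.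
Qed.

(** Monotonicity alone would allow a zero slope; if [f l = f l.-1], strict
    concavity would put the midpoint value above [f l]. *)
Lemma secant_gt0 l : (0 < l)%N -> 0 < secant f l.
Proof.
case: l => // l _; rewrite /secant /=.
have l0 : 0 <= l%:R :> R by exact: ler0n.
have lS : l.+1%:R = l%:R + 1 :> R by rewrite -natr1.
have /midpoint_lt-/(_ _ _)mid : l%:R != l.+1%:R :> R by rewrite eqr_nat; lia.
have {}mid := mid l0 (ler0n _ _).
have : f ((l%:R + l.+1%:R) / 2) <= f l.+1%:R by apply: f_incr; rewrite lS; lra.
by move: mid; lra.
Qed.

Lemma secant_lt l : (0 < l)%N -> secant f l.+1 < secant f l.
Proof.
case: l => // l _; rewrite /secant /=.
have /midpoint_lt-/(_ (ler0n _ _) (ler0n _ _)) : l%:R != l.+2%:R :> R.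
  by rewrite eqr_nat; lia.
have -> : (l%:R + l.+2%:R) / 2 = l.+1%:R :> R.
  by rewrite -(natr1 l.+1) -(natr1 l); lra.
by lra.
Qed.

Lemma interceptS l :
  intercept f l.+1 = intercept f l + (secant f l - secant f l.+1) * l%:R.
Proof. by rewrite /intercept /secant /= -natr1; ring. Qed.

Lemma intercept1 : intercept f 1 = 0.
Proof. by rewrite /intercept /secant /= f0; ring. Qed.

Lemma intercept_ge0 l : (0 < l)%N -> 0 <= intercept f l.
Proof.
elim: l => // -[_ _|l IH _]; first by rewrite intercept1.
rewrite interceptS addr_ge0 ?IH// mulr_ge0 ?ler0n// subr_ge0.
by rewrite ltW ?secant_lt.
Qed.

Lemma intercept_gt0 l : (1 < l)%N -> 0 < intercept f l.
Proof.
case: l => // -[//|l] _.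
rewrite interceptS ltr_wpDl ?intercept_ge0// mulr_gt0 ?ltr0n//.
by rewrite subr_gt0 secant_lt.
Qed.

Lemma secant_ge i j : (0 < i <= j)%N -> secant f j <= secant f i.
Proof.
move=> /andP[i0]; elim: j => [|j IH]; first by lia.
rewrite leq_eqVlt => /orP[/eqP <- //|ij].
by apply: le_trans (IH _); rewrite // ltW ?secant_lt//; lia.
Qed.

Lemma intercept_le i j : (0 < i <= j)%N -> intercept f i <= intercept f j.
Proof.
move=> /andP[i0]; elim: j => [|j IH]; first by lia.
rewrite leq_eqVlt => /orP[/eqP <- //|ij].
apply: le_trans (IH _) _; first by lia.
rewrite interceptS lerDl mulr_ge0 ?ler0n// subr_ge0.
by rewrite ltW ?secant_lt//; lia.
Qed.

Lemma foot_le i j : (0 < i <= j)%N -> foot f i <= foot f j.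
Proof.
move=> /[dup] ij /andP[i0 le_ij].
have ai := secant_gt0 i0; have aj : 0 < secant f j by apply: secant_gt0; lia.
rewrite ler_pdivrMr // mulrAC ler_pdivlMr //.
by apply: ler_pM (intercept_le ij) (secant_ge ij); rewrite ?intercept_ge0 ?ltW.
Qed.

(** Consecutive chords cross on the ray w = l c, so the sign of their difference
    is read off from w - l c. *)
Lemma chordS l w c :
  chord f l.+1 w c - chord f l w c =
  (secant f l.+1 - secant f l) * (w - l%:R * c).
Proof. by rewrite /chord interceptS; ring. Qed.

Lemma chord_end l w c : w = l%:R * c -> chord f l w c = f l%:R * c.
Proof. by move=> ->; rewrite /chord /intercept; ring. Qed.

Lemma chord_start l w c : (0 < l)%N -> w = l.-1%:R * c ->
  chord f l w c = f l.-1%:R * c.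
Proof.
case: l => // l _ /= ->.
by rewrite /chord /intercept /secant /= -natr1; ring.
Qed.

Lemma chord_foot l (w c : R) : (0 < l)%N ->
  chord f l w c = secant f l * (w + foot f l * c).
Proof.
move=> l0; have := secant_gt0 l0 => a0.
by rewrite /chord mulrDr mulrA mulrCA divff ?mulr1// gt_eqF.
Qed.

(** Induction on [j] to the right of the chord, where the secants are smaller;
    on the left, induction on the chord, as [chordS] compares neighbours. *)
Lemma concave_le_chord i j : (0 < i)%N -> f j%:R <= chord f i j%:R 1.
Proof.
move=> i0; have [ij|ji] := leqP i j.
  elim: j ij => [|j IH]; first by lia.
  rewrite leq_eqVlt => /orP[/eqP <-|ij].
    by rewrite (@chord_end i) ?mulr1.
  have {}IH := IH ij.
  have aS : secant f j.+1 <= secant f i by apply: secant_ge; lia.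
  rewrite /chord in IH *; rewrite -natr1.
  by move: aS; rewrite {1}/secant /= -natr1; lra.
elim: i i0 ji => // i IH _; rewrite ltnS leq_eqVlt => /orP[/eqP ->|ji].
  by rewrite (@chord_start i.+1) ?mulr1.
apply: le_trans (IH _ ji) _; first by lia.
rewrite -subr_ge0 chordS mulr1; apply: mulr_le0.
  by rewrite subr_le0 ltW ?secant_lt//; lia.
by rewrite subr_le0 ler_nat ltnW.
Qed.

End Chords.

Section Tangents.
Variables (R : realType) (f : R -> R) (m beta : nat).
Hypothesis f_concave : strictly_concave_nneg f.
Hypothesis f_incr : increasing_nneg f.
Hypothesis f0 : f 0 = 0.

Lemma increasing_ge0 z : 0 <= z -> 0 <= f z.
Proof. by move=> z0; rewrite -f0; apply: f_incr. Qed.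

Lemma ratio_foot l : (l <= m)%N -> Defs.ratio f m l = (foot f l)%:E.
Proof. by move=> lm; rewrite /Defs.ratio /coef_b /coef_a lm. Qed.

(** Common to both index sets: [rho] lies between the feet of the chords that
    end and start at [l], the latter foot being infinite for l = m. *)
Lemma tangent_foot_bounds (q : nat * R) : (L1 f m `|` L2 f m beta) q ->
  [/\ (0 < q.1 <= m)%N, 0 <= q.2, foot f q.1 <= q.2 &
      (q.1 < m)%N -> q.2 <= foot f q.1.+1].
Proof.
have foot_ge0 l : (0 < l)%N -> 0 <= foot f l.
  by move=> l0; rewrite divr_ge0 ?intercept_ge0// ltW// secant_gt0.
case: q => l rho [[/= /[dup] lm /andP[l0 lm1]]|[/= /[dup] lm /andP[l0 lm1] _]].
  rewrite ratio_foot// => -[->]; split; rewrite ?foot_ge0// => lm2.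
  by apply: foot_le => //; rewrite l0 leqnSn.
rewrite ratio_foot// lte_fin => lo hi.
split=> //; first by rewrite (le_trans (foot_ge0 _ l0))// ltW.
  exact: ltW.
by move=> lm2; move: hi; rewrite ratio_foot// lte_fin => /ltW.
Qed.

Lemma tangent_slope_ge0 l (rho : R) : 0 <= rho -> 0 <= f l%:R / (l%:R + rho).
Proof.
by move=> r0; apply: divr_ge0; [exact: increasing_ge0 | exact: addr_ge0].
Qed.

(** The bounds on [rho] place the slope of the line through (- rho, 0) and
    (l, f l) between those of the chords that end and start at [l], so this line
    is a tangent there.  For l = m no chord starts at [l], and j <= m leaves only
    points on the left of [l]. *)
Lemma concave_le_tangent l j (rho : R) : (0 < l <= m)%N -> (j <= m)%N ->
  0 <= rho -> foot f l <= rho -> ((l < m)%N -> rho <= foot f l.+1) ->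
  f j%:R <= f l%:R / (l%:R + rho) * (j%:R + rho).
Proof.
move=> /andP[l0 lm] jm r0 lo hi.
have l0R : 0 < l%:R :> R by rewrite ltr0n.
have lr : 0 < l%:R + rho by lra.
have al := secant_gt0 f_concave f_incr l0.
set s := _ / _.
have sE : s * (l%:R + rho) = f l%:R by rewrite /s divfK// gt_eqF.
have s_le : s <= secant f l.
  rewrite ler_pdivrMr// mulrDr -lerBlDl.
  by move: lo; rewrite ler_pdivrMr// mulrC.
have s_ge : (l < m)%N -> secant f l.+1 <= s.
  move=> lm2; have aS := secant_gt0 f_concave f_incr (ltn0Sn l).
  rewrite ler_pdivlMr// mulrDr -lerBrDl.
  have := hi lm2; rewrite ler_pdivlMr// mulrC => /le_trans; apply.
  by rewrite /intercept /secant /= -natr1; lra.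
have -> : s * (j%:R + rho) = f l%:R + s * (j%:R - l%:R) by rewrite -sE; ring.
have [jl|lj] := leqP j l.
  have jlR : j%:R <= l%:R :> R by rewrite ler_nat.
  apply: le_trans (concave_le_chord f_concave j l0) _.
  by rewrite /chord /intercept; nra.
have ljR : l%:R <= j%:R :> R by rewrite ler_nat ltnW.
have lm2 : (l < m)%N by lia.
apply: le_trans (concave_le_chord f_concave j (ltn0Sn l)) _.
have := s_ge lm2; rewrite /chord /intercept /secant /= -natr1.
by nra.
Qed.

End Tangents.

(** * Rounding the points of the cube in a slab *)

Section Slab.
Variables (R : realType) (n : nat).
Implicit Types x y xi : 'cV[R]_n.

Definition cube x : Prop := forall i, 0 <= x i 0 <= 1.

Definition frac x : {set 'I_n} := [set i | (x i 0 != 0) && (x i 0 != 1)]%SET.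

Let zero_eq1 : (0 == 1 :> R) = false.
Proof. by rewrite eq_sym oner_eq0. Qed.

Lemma binary_cube x : binary x -> cube x.
Proof. by move=> bx i; case: (bx i) => ->; lra. Qed.

Lemma frac0_binary x : frac x = finset.set0 -> binary x.
Proof.
move=> fx i; have := finset.in_set0 i; rewrite -fx inE.
by case: eqVneq => [->|_]; [left|case: eqVneq => // ->; right].
Qed.

Lemma cube_frac x i : cube x -> i \in frac x -> 0 < x i 0 < 1.
Proof.
by move=> /(_ i)/andP[x0 x1]; rewrite inE !lt_neqAle eq_sym x0 x1 !andbT.
Qed.

Lemma frac_lt x y i : i \in frac x -> i \notin frac y ->
  (forall j, j \notin frac x -> y j 0 = x j 0) -> (#|frac y| < #|frac x|)%N.
Proof.
move=> ix iy xy; apply/proper_card/properP; split; last by exists i.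
apply/fintype.subsetP => j; apply: contraTT => /[dup] jx /xy.
by move: jx; rewrite !inE => + ->.
Qed.

Lemma dotpE x xi : dotp x xi = \sum_i x i 0 * xi i 0.
Proof. by rewrite /dotp mxE; apply: eq_bigr => i _; rewrite mxE. Qed.

Lemma dotpD x y xi : dotp (x + y) xi = dotp x xi + dotp y xi.
Proof. by rewrite /dotp linearD /= mulmxDl mxE. Qed.

Lemma dotpZ a x xi : dotp (a *: x) xi = a * dotp x xi.
Proof. by rewrite /dotp linearZ /= -scalemxAl mxE. Qed.

Lemma dotp_delta i xi : dotp (delta_mx i 0) xi = xi i 0.
Proof.
rewrite dotpE (bigD1 i)//= big1 ?addr0 => [|j /negPf ji].
  by rewrite mxE !eqxx mul1r.
by rewrite mxE ji mul0r.
Qed.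

Lemma dotp_ones x xi : binary xi -> dotp x xi = \sum_(i in ones xi) x i 0.
Proof.
move=> bxi; rewrite dotpE [RHS]big_mkcond; apply: eq_bigr => i _.
rewrite inE; case: (bxi i) => ->; rewrite ?eqxx ?mulr1//.
by rewrite zero_eq1 mulr0.
Qed.

Lemma dotp_binary x xi : binary x -> binary xi ->
  exists2 k, (k <= #|ones xi|)%N & dotp x xi = k%:R.
Proof.
move=> bx bxi; exists #|ones xi :&: ones x|%SET.
  by apply/subset_leq_card/subsetIl.
rewrite dotp_ones// -sum1_card natr_sum big_mkcond [RHS]big_mkcond /=.
apply: eq_bigr => i _; rewrite !inE.
case: (bx i) => ->; rewrite ?eqxx ?andbT//.
by rewrite zero_eq1 andbF if_same.
Qed.

Variable T : set 'cV[R]_n.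
Hypothesis T_convex : forall x y t, 0 <= t <= 1 -> T x -> T y ->
  T (t *: x + (1 - t) *: y).

Lemma convex_between y d s t : 0 <= s -> 0 < t ->
  T (y - s *: d) -> T (y + t *: d) -> T y.
Proof.
move=> s0 t0 Ty1 Ty2; have st0 : 0 < s + t by lra.
have r01 : 0 <= t / (s + t) <= 1.
  by rewrite divr_ge0 ?ler_pdivrMr ?mul1r ?(ltW t0) ?(ltW st0)//=; lra.
have := T_convex r01 Ty1 Ty2; congr (T _).
apply/matrixP => i j; rewrite !mxE; field; lra.
Qed.

Variables (xi : 'cV[R]_n) (k : nat).
Hypothesis xi_binary : binary xi.

Definition slab y : Prop := k%:R <= dotp y xi <= k%:R + 1.

Hypothesis T_vertices : forall v, binary v -> slab v -> T v.

(** Fractional coordinates are removed one at a time, by moving along a line in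
    both directions until a coordinate becomes 0 or 1.  A coordinate outside
    [ones xi] moves alone, and two coordinates in [ones xi] move against each
    other; neither changes [dotp _ xi].  When a single fractional coordinate is
    left, the other ones contribute an integer, necessarily [k], so both
    roundings stay in the slab. *)
Lemma slab_rounding y : cube y -> slab y -> T y.
Proof.
have [N] := ubnP #|frac y|; elim: N y => // N IH y /ltnSE yN cy sy.
have [fy0|[i iy]] := set_0Vmem (frac y).
  by apply: T_vertices => //; exact: frac0_binary.
have yi := cube_frac cy iy.
pose e j : 'cV[R]_n := delta_mx j 0.
have dote s j : dotp (y + s *: e j) xi = dotp y xi + s * xi j 0.
  by rewrite dotpD dotpZ dotp_delta.
have yE s j l : (y + s *: e j) l 0 = y l 0 + s * (l == j)%:R.
  by rewrite /e !mxE eqxx andbT.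
(* Rounding one fractional coordinate leaves fewer of them. *)
have bnd v s j : j \in frac y -> y j 0 + s = v -> (v == 0) || (v == 1) ->
    cube (y + s *: e j) /\ (#|frac (y + s *: e j)%R| < #|frac y|)%N.
  move=> jy vE v01; split.
    move=> l; rewrite yE; case: eqVneq => [->|_]; last by rewrite mulr0 addr0.
    by rewrite mulr1 vE; case/orP: v01 => /eqP ->; lra.
  apply: (@frac_lt _ _ j) => // [|l ly].
    rewrite inE yE eqxx mulr1 vE.
    by case/orP: v01 => /eqP ->; rewrite ?eqxx ?andbF.
  rewrite yE; case: eqVneq => [lj|_]; last by rewrite mulr0 addr0.
  by rewrite lj jy in ly.
have ends j : j \in frac y -> T (y - y j 0 *: e j) ->
    T (y + (1 - y j 0) *: e j) -> T y.
  by move=> jy; have := cube_frac cy jy => ?; apply: convex_between; lra.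
have [/existsP[j /andP[jy /eqP xij]]|/existsPn xi1] :=
    boolP [exists j, (j \in frac y) && (xi j 0 == 0)].
  have yj := cube_frac cy jy.
  apply: (ends j) => //; rewrite -?scaleNr; apply: IH;
    rewrite /slab ?dote ?xij ?mulr0 ?addr0 //.
  - apply: leq_trans yN; apply: (bnd 0 _ j _ _ _).2; rewrite ?eqxx //; lra.
  - apply: (bnd 0 _ j _ _ _).1; rewrite ?eqxx //; lra.
  - apply: leq_trans yN; apply: (bnd 1 _ j _ _ _).2; rewrite ?eqxx ?orbT//; lra.
  - apply: (bnd 1 _ j _ _ _).1; rewrite ?eqxx ?orbT//; lra.
have {}xi1 j : j \in frac y -> xi j 0 = 1.
  by move=> jy; have := xi1 j; rewrite jy; case: (xi_binary j) => -> //; rewrite eqxx.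
have [/existsP[j /andP[jy ji]]|/existsPn uniq_i] :=
    boolP [exists j, (j \in frac y) && (j != i)].
  have yj := cube_frac cy jy.
  have dE s l : (y + s *: (e i - e j)) l 0 =
      y l 0 + s * ((l == i)%:R - (l == j)%:R).
    by rewrite /e !mxE eqxx !andbT.
  (* [hit] says that coordinate [i] or [j] has reached 0 or 1. *)
  have move_ok s : - y i 0 <= s <= 1 - y i 0 -> y j 0 - 1 <= s <= y j 0 ->
      [|| s == - y i 0, s == 1 - y i 0, s == y j 0 - 1 | s == y j 0] ->
      T (y + s *: (e i - e j)).
    move=> si sj hit.
    have di : (y + s *: (e i - e j)) i 0 = y i 0 + s.
      by rewrite dE eqxx eq_sym (negPf ji) subr0 mulr1.
    have dj : (y + s *: (e i - e j)) j 0 = y j 0 - s.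
      by rewrite dE eqxx (negPf ji) sub0r mulrN1.
    have dl l : l != i -> l != j -> (y + s *: (e i - e j)) l 0 = y l 0.
      by move=> /negPf li /negPf lj; rewrite dE li lj subrr mulr0 addr0.
    have same l : l \notin frac y -> (y + s *: (e i - e j)) l 0 = y l 0.
      by move=> ly; apply: dl; apply: contraNneq ly => ->.
    apply: IH.
    - apply: leq_trans yN.
      have [fi|fi] := boolP (i \in frac (y + s *: (e i - e j))); last first.
        exact: (@frac_lt _ _ i).
      apply: (@frac_lt _ _ j) => //; rewrite inE dj.
      move: fi; rewrite inE di.
      case/or4P: hit => /eqP ->; rewrite ?addrN ?eqxx ?andbF//.
      + by rewrite [y i 0 + _]addrC subrK eqxx andbF.
      + by rewrite opprB [y j 0 + (1 - _)]addrC subrK eqxx andbF.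
    - move=> l; have [->|li] := eqVneq l i; first by rewrite di; lra.
      have [->|lj] := eqVneq l j; first by rewrite dj; lra.
      by rewrite dl.
    - rewrite /slab dotpD dotpZ dotpD -scaleN1r dotpZ !dotp_delta !xi1//.
      by rewrite mulN1r subrr mulr0 addr0.
  pose s := Num.min (y i 0) (1 - y j 0).
  pose t := Num.min (1 - y i 0) (y j 0).
  apply: (@convex_between y (e i - e j) s t).
  - by rewrite /s; case: (leP (y i 0)) => ?; lra.
  - by rewrite /t; case: (leP (1 - y i 0)) => ?; lra.
  - by rewrite -scaleNr; apply: move_ok; rewrite /s; case: (leP (y i 0)) => ?; lra.
  - by apply: move_ok; rewrite /t; case: (leP (1 - y i 0)) => ?; lra.
have fyi j : j \in frac y -> j = i.
  by move=> jy; have := uniq_i j; rewrite jy negbK => /eqP.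
have bin v s : y i 0 + s = v -> (v == 0) || (v == 1) -> binary (y + s *: e i).
  move=> vE v01; apply: frac0_binary; apply/eqP; rewrite -cards_eq0 -leqn0 -ltnS.
  apply: leq_trans (bnd v s i iy vE v01).2 _.
  rewrite -(cards1 i); apply/subset_leq_card/fintype.subsetP => j /fyi ->.
  by rewrite inE.
have b0 : binary (y + (- y i 0) *: e i) by apply: (bin 0); rewrite ?eqxx//; lra.
have b1 : binary (y + (1 - y i 0) *: e i).
  by apply: (bin 1); rewrite ?eqxx ?orbT//; lra.
have [c _ cE] := dotp_binary b0 xi_binary.
rewrite dote xi1// mulr1 in cE.
have ck : c = k.
  move/andP: sy => [s1 s2].
  have : c%:R < k.+1%:R :> R by rewrite -natr1; lra.
  have : k%:R < c.+1%:R :> R by rewrite -natr1; lra.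
  by rewrite !ltr_nat; lia.
rewrite ck in cE.
apply: (ends i) => //; rewrite -?scaleNr; apply: T_vertices => //;
  by rewrite /slab dote xi1// mulr1; lra.
Qed.

End Slab.

(** * Capped sums and order statistics *)

Section CappedSum.
Variables (R : realType) (n : nat).
Implicit Types (x y xi : 'cV[R]_n) (c d : R).

Definition capped_sum xi x c : R := \sum_(i in ones xi) Num.min (x i 0) c.

(** A minimum of two linear functions of (x, c) is concave in (x, c). *)
Lemma capped_sum_concave xi x y c d t : 0 <= t <= 1 ->
  t * capped_sum xi x c + (1 - t) * capped_sum xi y d <=
  capped_sum xi (t *: x + (1 - t) *: y) (t * c + (1 - t) * d).
Proof.
move=> t01; rewrite !mulr_sumr -big_split /=; apply: ler_sum => i _.
rewrite !mxE le_min; apply/andP; split; apply: lerD;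
  by apply: ler_wpM2l; rewrite ?ge_min ?lexx ?orbT//; lra.
Qed.

Lemma capped_sum0 xi x : cube x -> capped_sum xi x 0 = 0.
Proof. by move=> cx; apply: big1 => i _; apply: min_r; case/andP: (cx i). Qed.

Lemma capped_sum1 xi x : binary xi -> cube x -> capped_sum xi x 1 = dotp x xi.
Proof.
move=> bxi cx; rewrite dotp_ones//; apply: eq_bigr => i _.
by apply: min_l; case/andP: (cx i).
Qed.

Lemma capped_sum_le xi x c d : c <= d -> capped_sum xi x c <= capped_sum xi x d.
Proof.
by move=> cd; apply: ler_sum => i _; rewrite le_min !ge_min lexx cd orbT.
Qed.

Lemma capped_sum_card xi x c : capped_sum xi x c <= #|ones xi|%:R * c.
Proof.
rewrite -sum1_card natr_sum mulr_suml; apply: ler_sum => i _.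
by rewrite mul1r ge_min lexx orbT.
Qed.

(** The two counts say that [x i 0] is the [k]-th largest of these
    coordinates, repetitions included. *)
Lemma order_statistic xi x k : (0 < k <= #|ones xi|)%N ->
  exists i, [/\ i \in ones xi,
    (k <= #|[set j in ones xi | (x i 0 <= x j 0)%R]%SET|)%N &
    (#|[set j in ones xi | (x i 0 < x j 0)%R]%SET| < k)%N].
Proof.
move=> /andP[k0 kN].
have [i0 i0xi] : exists i0, i0 \in ones xi.
  by apply/card_gt0P; apply: leq_trans kN.
pose P i := (i \in ones xi) &&
  (k <= #|[set j in ones xi | (x i 0 <= x j 0)%R]%SET|)%N.
have [i1 i1S min_i1] := arg_minP (fun i => x i 0) i0xi.
have i1xi : i1 \in ones xi := i1S.
have P1 : P i1.
  rewrite /P i1xi; apply: leq_trans kN _; apply/subset_leq_card.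
  by apply/fintype.subsetP => j jxi; rewrite inE jxi min_i1.
have [i /andP[ixi ki] max_i] := arg_maxP (fun i => x i 0) P1.
exists i; split=> //; rewrite ltnNge; apply/negP => kgt.
have [j0 j0S] : exists j0, j0 \in [set j in ones xi | (x i 0 < x j 0)%R]%SET.
  by apply/card_gt0P; apply: leq_trans kgt.
have [j jS min_j] := arg_minP (fun i => x i 0) j0S.
have : j \in [set j in ones xi | (x i 0 < x j 0)%R]%SET := jS.
rewrite inE => /andP[jxi ij].
suff /max_i : P j by rewrite /= leNgt ij.
rewrite /P jxi; apply: leq_trans kgt _; apply/subset_leq_card.
apply/fintype.subsetP => l lS; rewrite inE min_j// andbT.
by move: lS; rewrite inE => /andP[].
Qed.

(** At the [k]-th largest coordinate c, the left derivative of the capped sum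
    counts the coordinates >= c and is at least [k], and the right derivative
    counts the coordinates > c and is at most [k.-1]; every slope in between is
    a supergradient. *)
Lemma order_statistic_opt xi x k : cube x -> (0 < k <= #|ones xi|)%N ->
  exists2 c, 0 <= c <= 1 & forall g d, k.-1%:R <= g <= k%:R ->
    capped_sum xi x d - g * d <= capped_sum xi x c - g * c.
Proof.
move=> cx /[dup] k0N /order_statistic-/(_ x)[i [ixi kle klt]].
exists (x i 0) => // g d /andP[gk1 gk].
set c := x i 0 in kle klt *.
have diffE e e' : capped_sum xi x e' - capped_sum xi x e =
    \sum_(j in ones xi) (Num.min (x j 0) e' - Num.min (x j 0) e).
  by rewrite /capped_sum sumrB.
have count (P : pred 'I_n) e : \sum_(j in ones xi) (if P j then e else 0) =
    #|[set j in ones xi | P j]%SET|%:R * e :> R.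
  rewrite -big_mkcondr -sum1_card natr_sum mulr_suml.
  by apply: eq_big => [j|j _]; rewrite ?inE ?mul1r.
have [cd|dc] := leP c d.
  suff : capped_sum xi x d - capped_sum xi x c <= g * (d - c) by lra.
  apply: le_trans (_ : k.-1%:R * (d - c) <= _); last first.
    by apply: ler_wpM2r => //; lra.
  apply: le_trans (_ : #|[set j in ones xi | (c < x j 0)%R]%SET|%:R * (d - c) <= _).
    rewrite diffE -count; apply: ler_sum => j _.
    by case: (leP (x j 0) d); case: (leP (x j 0) c); lra.
  by apply: ler_wpM2r; rewrite ?ler_nat; [lra|lia].
suff : g * (c - d) <= capped_sum xi x c - capped_sum xi x d by lra.
apply: le_trans (_ : _ <= k%:R * (c - d)) _; first by apply: ler_wpM2r => //; lra.
apply: le_trans (_ : _ <= #|[set j in ones xi | (c <= x j 0)%R]%SET|%:R * (c - d)) _.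
  by apply: ler_wpM2r; rewrite ?ler_nat//; lra.
rewrite diffE -count; apply: ler_sum => j _.
by case: (leP (x j 0) d); case: (leP (x j 0) c); case: (leP c (x j 0)); lra.
Qed.

End CappedSum.

(** * The hulls of the hypographs in terms of caps *)

Section Hypographs.
Variables (R : realType) (n : nat) (f : R -> R) (xi : 'cV[R]_n) (beta : nat).
Hypothesis f_incr : increasing_nneg f.
Hypothesis f0 : f 0 = 0.
Hypothesis xi_binary : binary xi.

Local Notation phi := (capped_sum xi).

(** The right-hand side condition is convex in [(theta, x)], since a convex
    combination of two points is served by the same combination of their caps.
    On 0/1 vectors the caps 0 and 1 give the two branches of the positive
    part. *)
Lemma hull_hypoXh (q : nat * R) (theta : R) (x : 'cV[R]_n) :
  0 <= f q.1%:R / (q.1%:R + q.2) ->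
  convex_hull (hypoXh f xi beta q) (theta, x) ->
  cube x /\ exists2 c, 0 <= c <= 1 &
    theta <= f q.1%:R / (q.1%:R + q.2) * (phi x c - (beta%:R - q.2) * c).
Proof.
rewrite /hypoXh /h; set s := _ / _; set g := _ - q.2 => s0.
pose B : set (R^o * 'cV[R]_n) := [set p | cube p.2 /\
  exists2 c, 0 <= c <= 1 & p.1 <= s * (phi p.2 c - g * c)].
suff sub : convex_hull (hypoXh f xi beta q) `<=` B by move/sub.
apply: convex_hull_min.
  move=> [t1 x1] [t2 x2] t t01 [/= cx1 [c1 c101 le1]] [/= cx2 [c2 c201 le2]].
  split=> /=.
    move=> i; rewrite !mxE; have := cx1 i; have := cx2 i => h1 h2.
    by apply/andP; split; nra.
  exists (t * c1 + (1 - t) * c2); first by apply/andP; split; nra.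
  have conc := capped_sum_concave xi x1 x2 c1 c2 t01.
  apply: le_trans (_ : _ <= t * (s * (phi x1 c1 - g * c1)) +
    (1 - t) * (s * (phi x2 c2 - g * c2))) _.
    by apply: lerD; apply: ler_wpM2l => //; lra.
  have -> : t * (s * (phi x1 c1 - g * c1)) +
      (1 - t) * (s * (phi x2 c2 - g * c2)) =
    s * (t * phi x1 c1 + (1 - t) * phi x2 c2 - g * (t * c1 + (1 - t) * c2)).
    by ring.
  by apply: ler_wpM2l => //; lra.
move=> [t1 x1] [/= bx1]; rewrite /h -/s -/g => le1.
have cx1 := binary_cube bx1; split=> //=.
move: le1; rewrite /pospart; case: (leP (s * _) 0) => _ le1.
  by exists 0; rewrite ?lexx ?ler01//= capped_sum0// mulr0 subrr mulr0.
by exists 1; rewrite ?lexx ?ler01//= capped_sum1// mulr1.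
Qed.

(** Reduces membership in the hull to the 0/1 vectors of a slab: the set of [v]
    whose lift to the affine function lies in the hull is convex, so
    [slab_rounding] applies to it. *)
Lemma hull_hypoX_affine k (al tau theta : R) (y : 'cV[R]_n) :
  cube y -> slab xi k y ->
  (forall v, binary v -> slab xi k v ->
     al + tau * dotp v xi <= f (pospart (dotp v xi - beta%:R))) ->
  theta <= al + tau * dotp y xi ->
  convex_hull (hypoX f xi beta) (theta, y).
Proof.
move=> cy sy below le_theta.
(* Lowering the affine function by [del] makes its lift of [y] hit [theta]. *)
pose del := al + tau * dotp y xi - theta.
pose T : set 'cV[R]_n := [set v |
  convex_hull (hypoX f xi beta) (al - del + tau * dotp v xi, v)].
suff : T y.
  by rewrite /T /= (_ : al - _ + _ = theta) // /del; ring.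
apply: (@slab_rounding _ _ _ _ xi k) => // [v w t t01 Tv Tw|v bv sv].
  have := convex_hull_convex t01 Tv Tw; congr (convex_hull _ (_, _)).
  by rewrite dotpD !dotpZ /= /GRing.scale /=; ring.
apply: sub_gen_smallest; split=> //=; have := below v bv sv.
by rewrite /del; lra.
Qed.

Lemma hull_hypoX_le0 (theta : R) (y : 'cV[R]_n) : cube y -> theta <= 0 ->
  convex_hull (hypoX f xi beta) (theta, y).
Proof.
move=> cy le0.
have y0 : 0 <= dotp y xi.
  by rewrite dotp_ones//; apply: sumr_ge0 => i _; case/andP: (cy i).
have /andP[k1 k2] := Num.Theory.truncn_itv y0.
apply: (@hull_hypoX_affine (Num.truncn (dotp y xi)) 0 0) => //.
- by rewrite /slab k1 natr1 ltW.
- by move=> v _ _; rewrite mul0r addr0 increasing_ge0// le_max lexx orbT.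
- by rewrite mul0r addr0.
Qed.

(** Splits [x] as c (min(x, c) / c) + (1 - c) ((x - c)^+ / (1 - c)).  The first
    point lies in the slab of 0/1 vectors with beta + l - 1 or beta + l units,
    on which the chord coincides with the concave branch; the second one is
    lifted at height 0. *)
Lemma hull_hypoX_chord l (theta c : R) (x : 'cV[R]_n) :
  cube x -> 0 <= c <= 1 -> (0 < l)%N ->
  l.-1%:R * c <= phi x c - beta%:R * c <= l%:R * c ->
  theta <= chord f l (phi x c - beta%:R * c) c ->
  convex_hull (hypoX f xi beta) (theta, x).
Proof.
move=> cx /andP[c0 c1] l0 lev le_theta.
have [cz|cnz] := eqVneq c 0.
  apply: hull_hypoX_le0 => //; move: le_theta.
  by rewrite cz capped_sum0// /chord !mulr0 subr0 mulr0 addr0.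
have cp : 0 < c by rewrite lt_neqAle eq_sym cnz.
(* For c = 1, division by zero makes [z] vanish, and [y] is [x] itself. *)
pose y : 'cV[R]_n := \col_i (Num.min (x i 0) c / c).
pose z : 'cV[R]_n := \col_i ((x i 0 - Num.min (x i 0) c) / (1 - c)).
have xE : x = c *: y + (1 - c) *: z.
  apply/matrixP => i j; rewrite !ord1 !mxE mulrC divfK//.
  have [c1E|c1n] := eqVneq c 1; last by rewrite mulrC divfK; lra.
  rewrite c1E subrr mul0r addr0; apply/esym/min_l.
  by case/andP: (cx i).
have cy : cube y.
  move=> i; rewrite mxE divr_ge0 ?ler_pdivrMr ?mul1r// ?ge_min ?lexx ?orbT//.
  by rewrite le_min c0; case/andP: (cx i) => ->.
have cz : cube z.
  move=> i; rewrite mxE; have [c1E|c1n] := eqVneq c 1.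
    by rewrite c1E subrr invr0 mulr0 lexx ler01.
  have c1p : 0 < 1 - c by move/eqP: c1n; lra.
  rewrite divr_ge0 ?ler_pdivrMr ?mul1r ?(ltW c1p)//.
    by have := cx i; case: (leP (x i 0) c); lra.
  by rewrite subr_ge0 ge_min lexx.
have doty : dotp y xi = phi x c / c.
  rewrite dotp_ones// /capped_sum mulr_suml.
  by apply: eq_bigr => i _; rewrite mxE.
have yc : dotp y xi * c = phi x c by rewrite doty divfK.
have lS : l%:R = l.-1%:R + 1 :> R by rewrite natr1 prednK.
have hy : convex_hull (hypoX f xi beta) (theta / c, y).
  apply: (@hull_hypoX_affine (beta + l.-1)
    (intercept f l - secant f l * beta%:R) (secant f l)) => //.
  - rewrite /slab natrD; apply/andP; split.
      by rewrite -(ler_pM2r cp) yc; lra.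
    by rewrite -(ler_pM2r cp) yc; move: lev; rewrite lS; lra.
  - move=> v bv; rewrite /slab.
    have [N _ ->] := dotp_binary bv xi_binary => slv.
    have {slv}: (N == beta + l.-1)%N || (N == beta + l)%N.
      move: slv; rewrite natr1 !ler_nat; lia.
    have -> : intercept f l - secant f l * beta%:R + secant f l * N%:R =
      chord f l (N%:R - beta%:R) 1 by rewrite /chord; ring.
    rewrite /pospart => /orP[] /eqP ->; rewrite natrD addrC addKr max_l ?ler0n//.
      by rewrite chord_start ?mulr1.
    by rewrite (@chord_end _ _ l) ?mulr1.
  - rewrite ler_pdivrMr// mulrDl -mulrA yc.
    by move: le_theta; rewrite /chord; lra.
have hz := hull_hypoX_le0 cz (lexx 0).
have c01 : 0 <= c <= 1 by rewrite c0.
have := convex_hull_convex c01 hy hz; congr (convex_hull _ (_, _)) => //.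
change (c * (theta / c) + (1 - c) * 0 = theta).
by rewrite mulr0 addr0 mulrC divfK.
Qed.

End Hypographs.

(** * A cap that serves all tangents *)

Section Sweep.
Variables (R : realType) (f : R -> R).
Hypothesis f_concave : strictly_concave_nneg f.
Hypothesis f_incr : increasing_nneg f.
Hypothesis f0 : f 0 = 0.
Variables (m beta : nat) (phi : R -> R) (brk : nat -> R) (theta : R).
Hypothesis m_gt0 : (0 < m)%N.
Hypothesis phi0 : phi 0 = 0.
Hypothesis phi1 : phi 1 <= (beta + m)%:R.
Hypothesis phi_concave : forall x y t : R, 0 <= t <= 1 ->
  t * phi x + (1 - t) * phi y <= phi (t * x + (1 - t) * y).
Hypothesis brk0 : brk 0 = 1.
Hypothesis brk01 : forall k, (k <= beta)%N -> 0 <= brk k <= 1.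
Hypothesis brk_opt : forall k (g c : R), (k <= beta)%N -> g <= k%:R ->
  ((0 < k)%N -> k.-1%:R <= g) -> 0 <= c <= 1 ->
  phi c - g * c <= phi (brk k) - g * brk k.

Local Notation excess c := (phi c - beta%:R * c).

(* What the pairs of L1, then of L2, give: each of them has its own cap. *)
Hypothesis tangent1 : forall l, (0 < l <= m)%N ->
  exists2 c : R, 0 <= c <= 1 & theta <= chord f l (excess c) c.
Hypothesis tangent2 : forall p j, (0 < p <= m)%N -> (0 < j <= beta)%N ->
  foot f p < j%:R -> ((p < m)%N -> j%:R < foot f p.+1) ->
  exists2 c : R, 0 <= c <= 1 &
    theta <= f p%:R / (p%:R + j%:R) * (phi c - (beta%:R - j%:R) * c).

(** Exactly what [hull_hypoX_chord] asks of the cap [c]: the chord [l] is the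
    active one there and reaches [theta]. *)
Definition attained : Prop := exists c l,
  [/\ 0 <= c <= 1, (0 < l <= m)%N, l.-1%:R * c <= excess c <= l%:R * c &
      theta <= chord f l (excess c) c].

(** The chord [l] is maximised where phi(c) - g c is, for
    g = beta - foot f l, which is a slope supported at [brk k]. *)
Lemma chord_brk k l : (k <= beta)%N -> (0 < l <= m)%N ->
  beta%:R - k%:R <= foot f l ->
  ((0 < k)%N -> foot f l <= beta%:R - k.-1%:R) ->
  theta <= chord f l (excess (brk k)) (brk k).
Proof.
move=> kb lm lo hi; have [c c01] := tangent1 lm; move/le_trans; apply.
have l0 : (0 < l)%N by case/andP: lm.
rewrite !chord_foot// ler_pM2l ?secant_gt0//.
have gk : beta%:R - foot f l <= k%:R by lra.
have kg : (0 < k)%N -> k.-1%:R <= beta%:R - foot f l.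
  by move=> /hi; lra.
by have := brk_opt kb gk kg c01; lra.
Qed.

Lemma unit_step (p q : nat) (w c : R) : 0 <= c ->
  p%:R * c < w -> w <= q%:R * c ->
  exists l, [/\ (p < l <= q)%N, l.-1%:R * c <= w & w <= l%:R * c].
Proof.
move=> c0 pw wq.
have ex : exists l, w <= l%:R * c by exists q.
case: (ex_minnP ex) => l wl minl; exists l.
have pl : (p < l)%N.
  rewrite ltnNge; apply/negP => lp.
  have : l%:R * c <= p%:R * c by rewrite ler_wpM2r// ler_nat.
  lra.
split=> //; first by rewrite pl minl.
by rewrite leNgt; apply/negP => /ltW /minl; lia.
Qed.

(** The contact point [p] of the tangent to f from (- j, 0). *)
Lemma last_foot_le (j : nat) : exists p, [/\ (0 < p <= m)%N, foot f p <= j%:R &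
  forall l, (p < l <= m)%N -> j%:R < foot f l].
Proof.
pose P l := (0 < l <= m)%N && (foot f l <= j%:R).
have exP : exists l, P l.
  by exists 1%N; rewrite /P m_gt0 intercept1// mul0r ler0n.
have Pm l : P l -> (l <= m)%N by case/andP => /andP[].
case: (ex_maxnP exP Pm) => p /andP[pm pj] maxp; exists p; split=> // l lm.
rewrite ltNge; apply/negP => lj.
suff : (l <= p)%N by lia.
by apply: maxp; rewrite /P lj andbT; lia.
Qed.

(** The crossing between two breakpoints.  Both maximise phi(c) - k c, so this
    function is constant between them, and w(c) - p c is affine there with the
    explicit zero c = K / (p + j).  At this c the chord [p] and all the lines
    through the point (p, f p), among them the tangent from (- j, 0), take the
    same value f(p) c; hence a pair of L1 or of L2 bounds theta by it. *)
Lemma plateau (k p : nat) : (k < beta)%N -> (0 < p <= m)%N ->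
  foot f p <= (beta - k)%:R ->
  (forall l, (p < l <= m)%N -> (beta - k)%:R < foot f l) ->
  excess (brk k) <= p%:R * brk k ->
  p%:R * brk k.+1 <= excess (brk k.+1) ->
  attained.
Proof.
move=> kb pm rp rp1 wk wk1.
have p0 : 0 < p%:R :> R by rewrite ltr0n; case/andP: pm.
set j := (beta - k)%N in rp rp1.
have jE : j%:R = beta%:R - k%:R :> R by rewrite natrB// ltnW.
have j0 : 0 < j%:R :> R by rewrite ltr0n /j subn_gt0.
have pj0 : 0 < p%:R + j%:R :> R by rewrite addr_gt0.
set K := phi (brk k) - k%:R * brk k.
have optK c : 0 <= c <= 1 -> phi c - k%:R * c <= K.
  apply: brk_opt => //; first exact: ltnW.
  by move=> _; rewrite ler_nat leq_pred.
have K1 : phi (brk k.+1) - k%:R * brk k.+1 = K.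
  apply/eqP; rewrite eq_le optK ?brk01//=.
  apply: brk_opt; rewrite ?brk01//; last exact: ltnW.
  by rewrite ler_nat.
set c := K / (p%:R + j%:R).
have cK : c * (p%:R + j%:R) = K by rewrite /c divfK// gt_eqF.
have ck : c <= brk k.
  rewrite -(ler_pM2r pj0) cK /K jE; lra.
have ck1 : brk k.+1 <= c.
  rewrite -(ler_pM2r pj0) cK -K1 jE; lra.
have c01 : 0 <= c <= 1.
  have /andP[_ ?] := brk01 (ltnW kb); have /andP[? _] := brk01 kb; lra.
have phic : phi c - k%:R * c = K.
  apply/eqP; rewrite eq_le optK//=.
  have [d0|d0] := eqVneq (brk k) (brk k.+1).
    have -> : c = brk k by lra.
    by [].
  have d1 : 0 < brk k - brk k.+1 by move/eqP: d0; lra.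
  pose t := (c - brk k.+1) / (brk k - brk k.+1).
  have t01 : 0 <= t <= 1.
    by rewrite /t divr_ge0 ?ler_pdivrMr ?mul1r//=; lra.
  have cE : t * brk k + (1 - t) * brk k.+1 = c.
    by rewrite /t; field; lra.
  have := phi_concave (brk k) (brk k.+1) t01; rewrite cE => concv.
  have tK : t * K = t * phi (brk k) - t * (k%:R * brk k) by rewrite /K; ring.
  have tK1 : (1 - t) * K =
      (1 - t) * phi (brk k.+1) - (1 - t) * (k%:R * brk k.+1).
    by rewrite -K1; ring.
  have : k%:R * c = t * (k%:R * brk k) + (1 - t) * (k%:R * brk k.+1).
    by rewrite -cE; ring.
  by move: concv tK tK1; rewrite mulrBl mul1r; lra.
have wc : excess c = p%:R * c.
  by move: cK; rewrite -phic jE; lra.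
exists c, p; split=> //.
  rewrite wc lexx andbT ler_wpM2r ?ler_nat ?leq_pred//.
  by case/andP: c01.
rewrite (chord_end _ wc).
have [rpj|rpj] := eqVneq (foot f p) j%:R.
  have [d d01] := tangent1 pm; move/le_trans; apply.
  rewrite -(chord_end f wc) !(chord_foot f_concave f_incr); [|by case/andP: pm..].
  rewrite ler_pM2l ?secant_gt0//; last by case/andP: pm.
  by rewrite rpj jE; have := optK _ d01; rewrite -phic; lra.
have rlt : foot f p < j%:R by rewrite lt_neqAle rpj.
have rgt : (p < m)%N -> j%:R < foot f p.+1.
  by move=> ?; apply: rp1; rewrite leqnn.
have j0b : (0 < j <= beta)%N by rewrite /j; lia.
have [d d01] := tangent2 pm j0b rlt rgt; move/le_trans; apply.
have fp : 0 <= f p%:R by rewrite -{1}f0; apply: f_incr; rewrite ?lexx ?ltW.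
rewrite mulrAC ler_pdivrMr// -mulrA ler_wpM2l// cK.
by have := optK _ d01; rewrite jE; lra.
Qed.

(** Either a crossing has already occurred, or w(c) / c at [brk k] is still at
    most the contact point [p] of the tangent from (- (beta - k), 0).
    Passing from [k] to [k.+1], the value w(c) / c may jump over [p], which is
    the case of [plateau]; or the contact point may drop below it, and then it
    lies on a chord whose foot is in (beta - k - 1, beta - k], for which
    [brk k.+1] is optimal. *)
Lemma sweep k : (k <= beta)%N -> attained \/ exists p,
  [/\ (0 < p <= m)%N, foot f p <= (beta - k)%:R,
      forall l, (p < l <= m)%N -> (beta - k)%:R < foot f l &
      excess (brk k) <= p%:R * brk k].
Proof.
(* A crossing at the breakpoint [brk k'], on a chord between [p] and [q]. *)
have stop k' p q : (k' <= beta)%N ->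
    (forall l, (p < l <= q)%N -> [/\ (0 < l <= m)%N,
      beta%:R - k'%:R <= foot f l &
      (0 < k')%N -> foot f l <= beta%:R - k'.-1%:R]) ->
    p%:R * brk k' < excess (brk k') -> excess (brk k') <= q%:R * brk k' ->
    attained.
  move=> kb rl pw wq; have /andP[b0 b1] := brk01 kb.
  have [l [pl lo hi]] := unit_step b0 pw wq.
  have [lm r1 r2] := rl _ pl.
  exists (brk k'), l; split=> //; first by rewrite b0.
    by rewrite lo hi.
  exact: chord_brk.
elim: k => [_|k IH kb].
  have [p [pm rp rp1]] := last_foot_le (beta - 0).
  have [wp|wp] := lerP (excess (brk 0)) (p%:R * brk 0).
    by right; exists p.
  left; apply: (stop 0%N p m) => //; last first.
    by rewrite brk0 !mulr1; move: phi1; rewrite natrD; lra.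
  move=> l pl; split=> //; first by lia.
  by rewrite subr0; move: (rp1 _ pl); rewrite subn0 => /ltW.
have [|[p [pm rp rp1 wk]]] := IH (ltnW kb); first by left.
have [wp|wp] := lerP (p%:R * brk k.+1) (excess (brk k.+1)).
  by left; apply: (plateau kb pm).
have [q [qm rq rq1]] := last_foot_le (beta - k.+1).
have [wq|wq] := lerP (excess (brk k.+1)) (q%:R * brk k.+1).
  by right; exists q.
left; apply: (stop k.+1 q p) => //; last exact: ltW.
move=> l /andP[ql lp]; split; first by lia.
  by rewrite -natrB// ltW// rq1//; lia.
move=> _; rewrite -natrB 1?ltnW//=; apply: le_trans rp.
by apply: foot_le => //; lia.
Qed.

(** At k = beta the contact point is 1, the only chord with foot 0, and w is
    nonnegative because [brk beta] is at least as good as the cap 0; so the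
    sweep ends on the first chord. *)
Lemma sweep_attained : attained.
Proof.
have [//|[p]] := sweep (leqnn beta).
rewrite subnn => -[pm rp _ wp].
have /andP[b0 b1] := brk01 (leqnn beta).
have p1 : p = 1%N.
  apply/eqP; rewrite eqn_leq; case/andP: (pm) => -> _; rewrite andbT leqNgt.
  apply/negP => p1; move: rp; rewrite leNgt divr_gt0 ?secant_gt0//.
    exact: intercept_gt0.
  by case/andP: pm.
exists (brk beta), 1%N; split=> //=; first by rewrite b0.
  rewrite -p1 wp mul0r andbT.
  have := @brk_opt beta beta%:R 0 (leqnn _) (lexx _).
  rewrite phi0 mulr0 subrr; apply; rewrite ?lexx ?ler01// => _.
  by rewrite ler_nat leq_pred.
apply: chord_brk; rewrite ?intercept1 ?mul0r ?subrr//.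
by move=> _; rewrite subr_ge0 ler_nat leq_pred.
Qed.

End Sweep.

(** * The two inclusions *)

Lemma hypoX_sub_hypoXh (R : realType) (n : nat) (f : R -> R) (xi : 'cV[R]_n)
    (beta : nat) (q : nat * R) :
  strictly_concave_nneg f -> increasing_nneg f -> f 0 = 0 -> binary xi ->
  (L1 f (#|ones xi| - beta) `|` L2 f (#|ones xi| - beta) beta) q ->
  hypoX f xi beta `<=` hypoXh f xi beta q.
Proof.
move=> fc fi f0 bxi /(tangent_foot_bounds fc fi f0)[lm r0 lo hi].
move=> [theta x] [/= bx le_theta]; split=> //=; apply: le_trans le_theta _.
have [N NN ->] := dotp_binary bx bxi.
rewrite /h [X in _ <= X]/pospart le_max /pospart.
have [Nb|bN] := leqP N beta.
  by rewrite max_r ?f0 ?lexx ?orbT// subr_le0 ler_nat.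
have bN' := ltnW bN.
rewrite -natrB// max_l ?ler0n//.
have -> : N%:R - (beta%:R - q.2) = (N - beta)%:R + q.2 by rewrite natrB//; ring.
by rewrite (concave_le_tangent fc fi lm) ?leq_sub2r.
Qed.

Lemma bigcap_hull_sub (R : realType) (n : nat) (f : R -> R) (xi : 'cV[R]_n)
    (beta : nat) :
  strictly_concave_nneg f -> increasing_nneg f -> f 0 = 0 -> binary xi ->
  (beta < #|ones xi|)%N ->
  let m := (#|ones xi| - beta)%N in
  \bigcap_(q in L1 f m `|` L2 f m beta) convex_hull (hypoXh f xi beta q)
    `<=` convex_hull (hypoX f xi beta).
Proof.
move=> fc fi f0 bxi bN m [theta x] mem.
have m0 : (0 < m)%N by rewrite /m subn_gt0.
have bnd q : (L1 f m `|` L2 f m beta) q -> cube x /\ exists2 c, 0 <= c <= 1 &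
    theta <= f q.1%:R / (q.1%:R + q.2) *
      (capped_sum xi x c - (beta%:R - q.2) * c).
  move=> qL; apply: hull_hypoXh => //; last exact: mem.
  have [_ r0 _ _] := tangent_foot_bounds fc fi f0 qL.
  exact: tangent_slope_ge0.
have inL1 l : (0 < l <= m)%N ->
    (L1 f m `|` L2 f m beta) (l, foot f l).
  by move=> lm; left; split; rewrite //= ratio_foot//; case/andP: lm.
have [cx _] := bnd _ (inL1 1%N m0).
(* [brk 0 = 1] serves g <= 0; the order statistics serve k - 1 <= g <= k. *)
have brk_ex k : exists c, (k <= beta)%N ->
    [/\ 0 <= c <= 1, k = 0%N -> c = 1 & forall g d, g <= k%:R ->
      ((0 < k)%N -> k.-1%:R <= g) -> 0 <= d <= 1 ->
      capped_sum xi x d - g * d <= capped_sum xi x c - g * c].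
  case: k => [|k].
    exists 1 => _; split; rewrite ?lexx ?ler01// => g d g0 _ /andP[d0 d1].
    by have := capped_sum_le xi x d1; nra.
  have [kb|bk] := leqP k.+1 beta; last by exists 0; lia.
  have [|c c01 opt] := @order_statistic_opt _ _ xi x k.+1 cx; first by lia.
  exists c => _; split=> // g d gk /(_ isT) kg _.
  by apply: opt; rewrite kg gk.
have [brk brkP] := choice brk_ex.
suff : attained f m beta (capped_sum xi x) theta.
  move=> [c [l [c01 /andP[l0 _] lev le_theta]]].
  exact: (hull_hypoX_chord fi f0 bxi cx c01 l0 lev le_theta).
apply: (@sweep_attained _ f fc fi f0 m beta (capped_sum xi x) brk theta) => //.
- exact: capped_sum0.
- by have := capped_sum_card xi x 1; rewrite mulr1 subnKC// ltnW.
- move=> a b t t01; have := capped_sum_concave xi x x a b t01.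
  by rewrite -scalerDl [t + (1 - t)]addrC subrK scale1r.
- by have [_ ->] := brkP 0%N (leq0n _).
- by move=> k kb; have [] := brkP k kb.
- by move=> k g c kb gk kg c01; have [_ _] := brkP k kb; apply.
- move=> l lm; have [_ [c c01 le_theta]] := bnd _ (inL1 l lm).
  exists c => //; apply: le_trans le_theta _ => /=.
  have a0 : 0 < secant f l by apply: secant_gt0 => //; case/andP: lm.
  have l0 : 0 < l%:R :> R by rewrite ltr0n; case/andP: lm.
  have i0 : 0 <= intercept f l by apply: intercept_ge0 => //; case/andP: lm.
  have r0 : 0 <= foot f l by rewrite divr_ge0// ltW.
  (* For rho = foot f l the slope f(l) / (l + rho) is that of the chord. *)
  have -> : f l%:R = secant f l * (l%:R + foot f l).
    by rewrite mulrDr mulrCA divff ?gt_eqF// mulr1 /intercept; ring.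
  rewrite mulfK; last by rewrite gt_eqF//; lra.
  by rewrite le_eqVlt /chord; apply/orP; left; apply/eqP; field; rewrite gt_eqF.
- move=> p j pm jb lo hi.
  have pjL : (L1 f m `|` L2 f m beta) (p, j%:R).
    right; split=> //=; first by exists j.
      by rewrite ratio_foot ?lte_fin//; case/andP: pm.
    have [pm1|pm1] := ltnP p m; first by rewrite ratio_foot// lte_fin hi.
    by rewrite /Defs.ratio ltnNge pm1 /= ltry.
  by have [_] := bnd _ pjL.
Qed.

Theorem theorem2 (R : realType) (n : nat) (f : R -> R) (xi : 'cV[R]_n)
    (beta : nat)
    (f_concave : strictly_concave_nneg f)
    (f_incr : increasing_nneg f)
    (f0 : f 0 = 0)
    (xi_binary : binary xi)
    (beta_ge1 : (1 <= beta)%N)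
    (beta_le : (beta + 2 <= #|ones xi|)%N) :
  let m := (#|ones xi| - beta)%N in
  convex_hull (hypoX f xi beta) =
  \bigcap_(q in L1 f m `|` L2 f m beta) convex_hull (hypoXh f xi beta q).
Proof.
move=> m; apply/seteqP; split; last by apply: bigcap_hull_sub => //; lia.
move=> p hp q qL; move: p hp; apply: convex_hull_min.
  by move=> x y t t01 hx hy; exact: convex_hull_convex.
apply: subset_trans (@sub_gen_smallest _ _ _).
exact: hypoX_sub_hypoXh.
Qed.
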